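(* Let $H$ be a real Hilbert space, let $A:H\to 2^{H}$ be maximal monotone, and let $B:H\to H$ be $\beta$-cocoercive for some $\beta>0$. Suppose that $\Omega=\operatorname{zer}(A+B)\ne\emptyset$. Let $\{\gamma_k\}_{k\in\mathbb N}\subset(0,2\beta)$ and let $\{\lambda_k\}_{k\in\mathbb N}$ satisfy $\lambda_k\in(0,\frac1{\alpha_k})$, where $\alpha_k=\frac{2\beta}{4\beta-\gamma_k}$. Let $\{a_k\}$ and $\{b_k\}$ be sequences in $H$ such that $\sum_{k=0}^{+\infty}\lambda_k\|a_k\|<+\infty$ and $\sum_{k=0}^{+\infty}\lambda_k\|b_k\|<+\infty$. Let $x_0\in H$ and, for $k\in\mathbb N$, set $$y_k=x_k-\gamma_k(Bx_k+b_k),\qquad x_{k+1}=x_k+\lambda_k\big(J_{\gamma_kA}(y_k)+a_k-x_k\big).$$ Then: (i) For any $x^*\in\Omega$, $\lim_{k\to+\infty}\|x_k-x^*\|$ exists. Consider the following conditions, in which $\underline\lambda,\tau,\underline\gamma,\epsilon$ are constants and the inequalities are required for all $k$: (a1) $0<\underline\lambda\le\lambda_k$; (a2) $\lambda_k\le\frac1{\alpha_k}-\tau$, where $\tau\in(0,\frac1{\alpha_k}-\underline\lambda)$; (a3) $0<\underline\gamma\le\gamma_k$; (a4) $\gamma_k\le2\beta-\epsilon$, where $\epsilon\in(0,2\beta-\underline\gamma)$; (a5) $\sum_{k=0}^{+\infty}\lambda_k\big(\frac1{\alpha_k}-\lambda_k\big)=+\infty$ and $\sum_{k=0}^{+\infty}|\gamma_{k+1}-\gamma_k|<+\infty$.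 (ii) If (a1)–(a2) hold, or if (a3)–(a5) hold, then $\lim_{k\to+\infty}\|x_k-J_{\gamma_kA}(x_k-\gamma_kBx_k)\|=0$. (iii) If (a1)–(a3) hold, or if (a3)–(a5) hold, then $\{x_k\}$ converges weakly to a point in $\Omega$. (iv) If (a1)–(a3) hold, or if (a1) and (a3)–(a5) hold, then $Bx_k\to Bx^*$ strongly as $k\to+\infty$, where $x^*\in\Omega$.
   Context: $\mathbb N$ is the set of nonnegative integers. $B:H\to H$ is $\beta$-cocoercive if $\langle x-y,Bx-By\rangle\ge\beta\|Bx-By\|^2$ for all $x,y\in H$. $\operatorname{zer}(A+B)=\{x\in H:0\in Ax+Bx\}$. For $\gamma>0$, $J_{\gamma A}=(I+\gamma A)^{-1}$ is the resolvent of $A$ with index $\gamma$; it is single-valued and defined on all of $H$. *)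

(* Defs.v *)
From HB Require Import structures.
From mathcomp Require Import all_boot all_order all_algebra.
From mathcomp Require Import all_classical all_reals all_analysis.

Set Implicit Arguments.
Unset Strict Implicit.
Unset Printing Implicit Defensive.

Import Order.TTheory GRing.Theory Num.Theory.
Import numFieldNormedType.Exports.

Local Open Scope classical_set_scope.
Local Open Scope ring_scope.

(* A real Hilbert space is a complete normed module H together with a
   positive definite symmetric bilinear form dot that induces its norm. *)
Definition induces_norm (R : realType) (H : completeNormedModType R)
    (dot : {dot H for idfun}) : Prop :=
  forall x : H, `|x| = Num.sqrt (dot x x).

Section Operators.
Variables (R : realType) (H : completeNormedModType R) (dot : {dot H for idfun}).
Implicit Types (A : H -> set H) (B : H -> H) (gam : R).

Definition monotone A : Prop :=
  forall x y u v, A x u -> A y v -> 0 <= dot (x - y) (u - v).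

Definition maximal_monotone A : Prop :=
  monotone A /\
  forall A', monotone A' -> (forall x, A x `<=` A' x) -> forall x, A' x = A x.

Definition cocoercive (beta : R) B : Prop :=
  forall x y, beta * `|B x - B y| ^+ 2 <= dot (x - y) (B x - B y).

Definition op_zeros A : set H := [set x | A x 0].

Definition op_add A B : H -> set H := fun x => [set u + B x | u in A x].

Definition op_inverse A : H -> set H := fun y => [set x | A x y].

Definition id_plus_scale gam A : H -> set H :=
  fun x => [set x + gam *: u | u in A x].

Definition resolvent_op gam A : H -> set H := op_inverse (id_plus_scale gam A).

(* For maximal monotone A and gam > 0, resolvent_op gam A is everywhere
   defined and single-valued, so xget picks its unique value and the default
   0 is never reached. *)
Definition resolvent gam A (y : H) : H := xget 0 (resolvent_op gam A y).

Definition weakly_cvg (x : nat -> H) (l : H) : Prop :=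
  forall h : H, (fun k => dot (x k) h) @ \oo --> dot l h.

End Operators.

(* Main.v *)
Require Import Defs.
From HB Require Import structures.
From mathcomp Require Import all_boot all_order all_algebra.
From mathcomp Require Import all_classical all_reals all_analysis.
From mathcomp Require Import ring lra.

(** Write T_g for the forward-backward map x |-> J_{gA}(x - g B x) and r_g for
    its residual x - T_g x. The zeros of A + B are exactly the zeros of r_g,
    for any g > 0, and everything is driven by one inequality: adding the
    monotonicity of A along the resolvents to the cocoercivity of B gives
    [fb_residual_firm], hence [fb_residual_cocoercive]: r_g is
    theta/2-cocoercive with theta = 2 - g/(2 beta) = 1/alpha. With theta in
    place of 1/alpha, the hypothesis on the relaxation reads 0 < lam < theta.

    The exact step x - lam r_g(x) then moves towards every zero of A + B, with
    a gain lam (theta - lam) |r_g(x)|^2 ([fb_relax_fejer]), and the error terms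
    a_k, b_k perturb it by a summable amount. Hence the distances to a zero
    converge, which is (i), and the gains are summable ([residual_sum]). If
    the weights lam_k (theta_k - lam_k) are bounded below, the residuals tend
    to 0. If their sum diverges, the residuals cannot stay away from 0, and it
    is enough that their norms converge: cocoercivity also shows that an exact
    step does not increase |r_g| ([fb_residual_relax]), and replacing g_k by
    g_{k+1} costs O(|g_{k+1} - g_k|) when g_k is bounded below
    ([fb_residual_index]). This is (ii).

    For (iii), a weak limit of the iterates along any ultrafilter finer than
    the tails of nat is a zero of A + B ([weak_limit_zero]), and two such
    zeros coincide because both distances converge ([Opial_weak_cvg]). For
    (iv), [fb_residual_firm] bounds |B x_k - B x*|^2 by a multiple of the
    residual.

    Two facts about Hilbert spaces are needed: resolvents of maximal monotone
    operators are everywhere defined ([Minty_origin]), and bounded families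
    have weak limits along ultrafilters ([ultra_weak_cvg], through
    [Riesz_representation]). Both come from minimizing a strongly convex
    function, whose minimizing sequences are Cauchy
    ([minimizing_sequence_cvg]), so that no prior weak compactness is used. *)

Set Implicit Arguments.
Unset Strict Implicit.
Unset Printing Implicit Defensive.

Import Order.TTheory GRing.Theory Num.Theory.
Import numFieldNormedType.Exports.

Local Open Scope classical_set_scope.
Local Open Scope ring_scope.

(** * Inner products and minimization of strongly convex functions *)

(** First-order optimality: the shape in which minimality along a segment is
    turned into a variational inequality. *)
Lemma quadratic_ge0_slope (R : realType) (D E : R) :
  (forall s, 0 < s <= 1 -> 0 <= s * D + s ^+ 2 * E) -> 0 <= D.
Proof.
move=> h; rewrite leNgt; apply/negP => D0.
(* If D < 0, the value at s = - D / K is (D / K)^2 (E - K), which is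
   negative as K > E; K >= - D and K >= 1 keep s in the unit interval. *)
pose K := 1 + `|D| + `|E|.
have K1 : 1 <= K by rewrite /K; have := normr_ge0 D; have := normr_ge0 E; lra.
have K0 : 0 < K by apply: lt_le_trans K1.
have := h (- D / K); rewrite divr_gt0 ?oppr_gt0 // ler_pdivrMr // mul1r.
have -> : (- D <= K).
  by rewrite /K; have := ler_norm (- D); rewrite normrN; have := normr_ge0 E; lra.
move=> /(_ isT); rewrite leNgt => /negP; apply.
have -> : - D / K * D + (- D / K) ^+ 2 * E = (D / K) ^+ 2 * (E - K).
  by field; rewrite gt_eqF.
rewrite pmulr_rlt0; first by rewrite /K; have := ler_norm E; have := normr_ge0 D; lra.
by rewrite exprn_even_gt0 //= mulf_neq0 ?invr_eq0 ?(lt_eqF D0) ?(gt_eqF K0).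
Qed.

Section InnerProduct.
Variables (R : realType) (H : completeNormedModType R).
Variables (dot : {dot H for idfun}) (dot_norm : induces_norm dot).
Implicit Types (x y z : H) (c : R).

Lemma dotC x y : dot x y = dot y x.
Proof. by rewrite hermC /= expr0 mul1r. Qed.

Lemma dotDl x y z : dot (x + y) z = dot x z + dot y z.
Proof. exact: linearDl. Qed.
Lemma dotDr x y z : dot z (x + y) = dot z x + dot z y.
Proof. exact: linearDr. Qed.
Lemma dotNl x z : dot (- x) z = - dot x z.
Proof. exact: linearNl. Qed.
Lemma dotNr x z : dot z (- x) = - dot z x.
Proof. exact: linearNr. Qed.
Lemma dotZl c x z : dot (c *: x) z = c * dot x z.
Proof. exact: linearZl_LR. Qed.
Lemma dotZr c x z : dot z (c *: x) = c * dot z x.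
Proof. exact: linearZr_LR. Qed.
Lemma dot0l z : dot 0 z = 0.
Proof. exact: linear0l. Qed.

Definition dotE := (dotDl, dotDr, dotNl, dotNr, dotZl, dotZr).

Lemma dotxx x : dot x x = `|x| ^+ 2.
Proof.
rewrite dot_norm sqr_sqrtr //; have [->|x0] := eqVneq x 0; first by rewrite dot0l.
exact/ltW/neq0_dnorm_gt0.
Qed.

Lemma Cauchy_Schwarz x y : `|dot x y| <= `|x| * `|y|.
Proof.
have [->|y0] := eqVneq y 0; first by rewrite dotC dot0l !normr0 mulr0.
(* w is |y|^2 times the component of x orthogonal to y. *)
pose w := `|y| ^+ 2 *: x - dot x y *: y.
have h : 0 <= dot w w by rewrite dotxx sqr_ge0.
have y2 : 0 < `|y| ^+ 2 by rewrite exprn_gt0 ?normr_gt0.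
rewrite -(@ler_pXn2r _ 2) ?nnegrE ?mulr_ge0 // real_normK ?num_real //.
move: h; rewrite !dotE !dotxx (dotC y x) exprMn => h.
rewrite -subr_ge0 -(pmulr_rge0 _ y2).
by apply: le_trans h _; rewrite le_eqVlt; apply/orP; left; apply/eqP; ring.
Qed.

Lemma dot_le_norm x y : dot x y <= `|x| * `|y|.
Proof. exact: le_trans (ler_norm _) (Cauchy_Schwarz _ _). Qed.

Lemma le_norm_of_dot x y : `|x| ^+ 2 <= dot x y -> `|x| <= `|y|.
Proof.
move=> xy; have [->|x0] := eqVneq x 0; first by rewrite normr0.
have := le_trans xy (dot_le_norm x y); rewrite expr2 ler_pM2l //.
by rewrite normr_gt0.
Qed.

Lemma cvg_dotl (T : Type) (F : set_system T) (FF : Filter F) (f : T -> H) x z :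
  f @ F --> x -> dot (f t) z @[t --> F] --> dot x z.
Proof.
move=> fx; apply/cvgrPdist_lt => e e0.
have z1 : 0 < `|z| + 1 by rewrite ltr_wpDl.
have ez : 0 < e / (`|z| + 1) by rewrite divr_gt0.
move/cvgrPdist_lt: fx => /(_ _ ez); apply: filterS => t xft; rewrite -dotNl -dotDl.
apply: le_lt_trans (Cauchy_Schwarz _ _) _.
rewrite ltr_pdivlMr // in xft; apply: le_lt_trans xft.
by rewrite ler_wpM2l // lerDl.
Qed.

Lemma cvg_sqr (T : Type) (F : set_system T) (FF : Filter F) (f : T -> R) (c : R) :
  f @ F --> c -> f t ^+ 2 @[t --> F] --> c ^+ 2.
Proof. by move=> fc; rewrite expr2; under eq_fun do rewrite expr2; exact: cvgM. Qed.

Lemma minimizing_sequence (T : Type) (f : T -> R) (t0 : T) (b : R) :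
  (forall t, b <= f t) ->
  exists m (s : nat -> T), (forall t, m <= f t) /\ f \o s @ \oo --> m.
Proof.
move=> bf; have hi : has_inf (range f).
  by split; [exists (f t0), t0 | exists b => _ [t _ <-]].
have ex n : exists t, f t < inf (range f) + n.+1%:R^-1.
  have e0 : 0 < n.+1%:R^-1 :> R by rewrite invr_gt0.
  have [_ [t _ <-] ft] := inf_adherent e0 hi.
  by exists t.
have [s sP] := choice ex; exists (inf (range f)), s.
have lb t : inf (range f) <= f t by apply: ge_inf; [exact: hi.2 | exists t].
split=> //; apply/cvgrPdist_lt => e e0.
near=> n; rewrite distrC ger0_norm ?subr_ge0 ?lb //= ltrBlDl.
apply: lt_trans (sP n) _; rewrite ltrD2l.
by near: n; exact: near_infty_natSinv_lt (PosNum e0).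
Unshelve. all: by end_near. Qed.

(** Completeness replaces weak compactness here: two near-minimizers whose
    images under p were far apart would have a midpoint below the infimum. The
    function f lives on an index type and p extracts a component, so that one
    minimizing sequence can serve several components, as in Minty's theorem. *)
Lemma minimizing_sequence_cvg (T : Type) (f : T -> R) (p : T -> H) (c m : R)
    (s : nat -> T) :
  0 < c -> (forall t, m <= f t) -> f \o s @ \oo --> m ->
  (forall t u, exists r, f r <= (f t + f u) / 2 - c * `|p t - p u| ^+ 2) ->
  cvg (p \o s @ \oo).
Proof.
move=> c0 mf fs mid; apply/cauchy_cvgP/cauchy_exP => e e0.
have ce : 0 < c * e ^+ 2 by rewrite mulr_gt0 // exprn_gt0.
have near_m : \forall n \near \oo, f (s n) < m + c * e ^+ 2.
  move/cvgrPdistC_lt: fs => /(_ _ ce); apply: filterS => n /=.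
  by move/(le_lt_trans (ler_norm _)); rewrite ltrBlDl.
have [N fN] := filter_ex near_m.
exists (p (s N)); apply: filterS near_m => n fn /=.
rewrite -ball_normE /=; have [r fr] := mid (s N) (s n).
rewrite -(@ltr_pXn2r _ 2) ?nnegrE ?(ltW e0) // -(ltr_pM2l c0).
have := mf r; lra.
Qed.

Lemma dot_midpoint x y :
  `|2^-1 *: (x + y)| ^+ 2 = (`|x| ^+ 2 + `|y| ^+ 2) / 2 - `|x - y| ^+ 2 / 4.
Proof. by rewrite -!dotxx !dotE (dotC y x); field. Qed.

End InnerProduct.

(** * Minty's theorem *)
Section Minty.
Variables (R : realType) (H : completeNormedModType R).
Variables (dot : {dot H for idfun}) (dot_norm : induces_norm dot).
Implicit Types (A : H -> set H) (x y u v w : H).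
Let dotC := dotC dot.
Let dotE := dotE dot.
Let dotxx := dotxx dot_norm.

(** The form in which maximality is used; unlike the maximality of a graph
    among monotone graphs, it transfers at once to translates and multiples. *)
Definition monotonically_complete A : Prop :=
  forall x u, (forall y v, A y v -> 0 <= dot (x - y) (u - v)) -> A x u.

Lemma maximal_monotone_complete A :
  maximal_monotone dot A -> monotonically_complete A.
Proof.
move=> [Am Amax] x u xu.
(* Adjoin the pair (x, u) to the graph. *)
pose A' y : set H := [set v | A y v \/ (y = x /\ v = u)].
rewrite -(Amax A') //; first by right.
- move=> y y' v v' [Ayv|[-> ->]] [Ay'v'|[-> ->]].
  + exact: Am.
  + by have := xu _ _ Ayv; rewrite -[x - y]opprB -[u - v]opprB dotNl dotNr opprK.
  + exact: xu.
  + by rewrite subrr dot0l.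
- by move=> y v; left.
Qed.

(** Surjectivity of I + A at the origin. Let F (x, u) be the supremum over the
    graph of A of <x,b> + <a,u> - <a,b> (the Fitzpatrick function). It is convex
    and at least <x,u>, so F (x, u) + (|x|^2 + |u|^2)/2 >= |x + u|^2/2 >= 0
    has a minimizer. Optimality tested on the graph of A, where
    F (a, b) = <a,b>, says |x + u|^2 <= <-u - a, -x - b>; completeness puts
    (-u, -x) in the graph, and then taking (a, b) = (-u, -x) gives x = -u.
    The epigraph C of F stands for F, so that no infinite value occurs. *)
Lemma Minty_origin A : Defs.monotone dot A -> monotonically_complete A ->
  exists x, A x (- x).
Proof.
move=> Am Ac.
pose C := {p : H * H * R | forall a b, A a b ->
  dot p.1.1 b + dot a p.1.2 - dot a b <= p.2}.
pose X (p : C) := (sval p).1.1; pose U (p : C) := (sval p).1.2.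
pose t (p : C) := (sval p).2.
pose f p := t p + (`|X p| ^+ 2 + `|U p| ^+ 2) / 2.
have CP (p : C) a b : A a b -> dot (X p) b + dot a (U p) - dot a b <= t p.
  by move=> /(svalP p).
(* The points of the graph, at height <a,b>: this is where F (a, b) = <a,b>. *)
have CgraA a b : A a b -> exists p : C, [/\ X p = a, U p = b & t p = dot a b].
  move=> Aab; suff Pab : forall a' b', A a' b' ->
      dot (a, b, dot a b).1.1 b' + dot a' (a, b, dot a b).1.2 - dot a' b'
        <= (a, b, dot a b).2 by exists (exist _ _ Pab).
  move=> a' b' /= /(Am _ _ _ _ Aab); rewrite !dotE; lra.
(* F >= <.,.>: otherwise (X p, U p) is strictly monotonically related to
   every point of the graph, hence in the graph, hence strictly related to
   itself. *)
have t_ge (p : C) : dot (X p) (U p) <= t p.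
  rewrite leNgt; apply/negP => lt_t.
  have Ap : A (X p) (U p).
    by apply: Ac => a b /(CP p); rewrite !dotE; lra.
  by have := CP p _ _ Ap; lra.
have f_ge0 p : 0 <= f p.
  have := t_ge p; have : 0 <= dot (X p + U p) (X p + U p).
    by rewrite dotxx sqr_ge0.
  by rewrite !dotE !dotxx (dotC (U p)) /f; lra.
have [p0 _] : exists p : C, True.
  have [[a [b Aab]]|nA] := pselect (exists a b, A a b).
    by have [p _] := CgraA _ _ Aab; exists p.
  have A00 : A 0 0 by apply: Ac => y v Ayv; case: nA; exists y, v.
  by have [p _] := CgraA _ _ A00; exists p.
have conv (p q : C) (s : R) : 0 <= s <= 1 -> exists r : C,
    [/\ X r = (1 - s) *: X p + s *: X q,
        U r = (1 - s) *: U p + s *: U q & t r = (1 - s) * t p + s * t q].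
  move=> /andP[s0 s1]; pose r := ((1 - s) *: X p + s *: X q,
    (1 - s) *: U p + s *: U q, (1 - s) * t p + s * t q).
  suff rP : forall a b, A a b -> dot r.1.1 b + dot a r.1.2 - dot a b <= r.2.
    by exists (exist _ _ rP).
  move=> a b Aab; rewrite /= !dotE; have := CP p _ _ Aab; have := CP q _ _ Aab.
  nra.
have mid (p q : C) : exists r : C, f r <= (f p + f q) / 2 -
    (`|X p - X q| ^+ 2 + `|U p - U q| ^+ 2) / 8.
  have [r [Xr Ur tr]] := conv p q 2^-1 ltac:(lra).
  exists r; rewrite /f Xr Ur.
  have half : 1 - 2^-1 = 2^-1 :> R by lra.
  by rewrite half -!scalerDr !(dot_midpoint dot_norm) tr; lra.
have [m [s [mf fs]]] := minimizing_sequence p0 f_ge0.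
have lim (p : C -> H) : (forall q r : C, `|p q - p r| ^+ 2 <=
    `|X q - X r| ^+ 2 + `|U q - U r| ^+ 2) -> cvg (p \o s @ \oo).
  move=> pXU; apply: (@minimizing_sequence_cvg _ _ _ f p 8^-1 m s) => // q r.
  by have [z fz] := mid q r; exists z; have := pXU q r; lra.
have /cvg_ex[/= x Xs] := lim X ltac:(by move=> q r; rewrite lerDl sqr_ge0).
have /cvg_ex[/= u Us] := lim U ltac:(by move=> q r; rewrite lerDr sqr_ge0).
pose t0 := m - (`|x| ^+ 2 + `|u| ^+ 2) / 2.
have ts : t \o s @ \oo --> t0.
  have -> : t \o s = fun n => f (s n) - (`|X (s n)| ^+ 2 + `|U (s n)| ^+ 2) / 2.
    by apply/funext => n /=; rewrite /f; ring.
  apply: cvgB => //; apply: cvgMr_tmp; apply: cvgD.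
    by apply: cvg_sqr; exact: cvg_norm.
  by apply: cvg_sqr; exact: cvg_norm.
(* The epigraph is closed: the limit of the minimizing sequence is in it. *)
have [p [Xp Up tp]] : exists p : C, [/\ X p = x, U p = u & t p = t0].
  suff P0 : forall a b, A a b -> dot (x, u, t0).1.1 b + dot a (x, u, t0).1.2
      - dot a b <= (x, u, t0).2 by exists (exist _ _ P0).
  move=> a b Aab /=; apply: (ler_cvg_to
    (f := fun n => dot (X (s n)) b + dot a (U (s n)) - dot a b) _ ts).
    apply: cvgB; last exact: cvg_cst.
    apply: cvgD; first exact: cvg_dotl.
    rewrite dotC; under eq_fun do rewrite dotC; exact: cvg_dotl.
  by apply: nearW => n; exact: CP.
(* The variational inequality at the minimizer (x, u, t0), in the direction
   of a point of the graph. *)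
have main a b : A a b -> `|x + u| ^+ 2 <= dot (- u - a) (- x - b).
  move=> Aab; have [q [Xq Uq tq]] := CgraA _ _ Aab.
  have slope : 0 <= dot a b - t0 + dot x (a - x) + dot u (b - u).
    apply: (@quadratic_ge0_slope _ _ ((`|a - x| ^+ 2 + `|b - u| ^+ 2) / 2)).
    move=> c /andP[c0 c1]; have [r [Xr Ur tr]] := conv p q c ltac:(lra).
    have := mf r; rewrite /f Xr Ur tr Xp Up tp Xq Uq tq /t0 -!dotxx !dotE.
    by rewrite (dotC a x) (dotC b u); nra.
  have := t_ge p; rewrite Xp Up tp => le_t0.
  move: slope; rewrite -dotxx !dotE !dotxx (dotC u x) (dotC a x).
  by lra.
have Aux : A (- u) (- x).
  by apply: Ac => a b /main; apply: le_trans; rewrite sqr_ge0.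
have /eqP : `|x + u| ^+ 2 = 0.
  apply/eqP; rewrite eq_le sqr_ge0 andbT; have := main _ _ Aux.
  by rewrite !subrr dot0l.
rewrite sqrf_eq0 normr_eq0 addr_eq0 => /eqP xu.
by exists x; rewrite {1}xu.
Qed.

End Minty.

(** * Resolvents and the forward-backward residual *)
Section ForwardBackward.
Variables (R : realType) (H : completeNormedModType R).
Variables (dot : {dot H for idfun}) (dot_norm : induces_norm dot).
Variables (A : H -> set H) (A_max : maximal_monotone dot A).
Variables (B : H -> H) (beta : R) (beta_gt0 : 0 < beta).
Variable (B_coco : cocoercive dot beta B).
Implicit Types (x y z u v w : H) (g : R).
Let dotC := dotC dot.
Let dotE := dotE dot.
Let dotxx := dotxx dot_norm.
Let le_norm_of_dot := le_norm_of_dot dot_norm.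

(** Minty's theorem at the origin for the operator z |-> g A z - y; with it
    the choice of a preimage in the resolvent is never the default one. *)
Lemma resolventP g y : 0 < g ->
  A (resolvent g A y) (g^-1 *: (y - resolvent g A y)).
Proof.
move=> g0; have gN0 : g != 0 by rewrite gt_eqF.
have [Am _] := A_max.
have [x Ax] : exists x, A x (g^-1 *: (- x + y)).
  apply: (Minty_origin dot_norm (A := fun z v => A z (g^-1 *: (v + y)))).
    move=> z z' v v' /= Azv /(Am _ _ _ _ Azv).
    by rewrite -scalerBr dotZr pmulr_rge0 ?invr_gt0 // opprD addrACA subrr addr0.
  move=> z v zv; apply: (maximal_monotone_complete A_max) => z' v' Az'v'.
  have := zv z' (g *: v' - y).
  rewrite subrK scalerA mulVf // scale1r => /(_ Az'v').
  have -> : v - (g *: v' - y) = g *: (g^-1 *: (v + y) - v').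
    by rewrite scalerBr scalerA mulfV // scale1r opprB addrCA addrA [y + v]addrC.
  by rewrite dotZr pmulr_rge0.
have xP : resolvent_op g A y x.
  exists (g^-1 *: (- x + y)) => //.
  by rewrite scalerA mulfV // scale1r addNKr.
have [u Au uy] := xgetPex 0 (ex_intro _ x xP).
suff -> : g^-1 *: (y - resolvent g A y) = u by [].
by rewrite -[X in X - _]uy addrC addKr scalerA mulVf // scale1r.
Qed.

(** Firm nonexpansiveness of the resolvent, as an inner product that is
    convenient to expand. *)
Lemma resolvent_firm g y z : 0 < g ->
  0 <= dot (resolvent g A y - resolvent g A z)
           ((y - resolvent g A y) - (z - resolvent g A z)).
Proof.
move=> g0; have [Am _] := A_max.
have := Am _ _ _ _ (resolventP y g0) (resolventP z g0).
by rewrite -scalerBr dotZr pmulr_rge0 ?invr_gt0.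
Qed.

Lemma resolvent_nonexpansive g y z : 0 < g ->
  `|resolvent g A y - resolvent g A z| <= `|y - z|.
Proof.
move=> g0; apply: le_norm_of_dot; have := resolvent_firm y z g0.
rewrite -dotxx /= !dotE; lra.
Qed.

Definition fb_residual g x := x - resolvent g A (x - g *: B x).
Local Notation res := fb_residual.

(** The key inequality. With d = x - y, q = r_g x - r_g y and e = B x - B y,
    monotonicity of A gives <d - q, q - g e> >= 0, and cocoercivity of B bounds
    the term g <d, e> from below by g beta |e|^2. *)
Lemma fb_residual_firm g x y : 0 < g ->
  `|res g x - res g y| ^+ 2 + g * beta * `|B x - B y| ^+ 2
    - g * dot (res g x - res g y) (B x - B y) <= dot (x - y) (res g x - res g y).
Proof.
move=> g0; have := resolvent_firm (x - g *: B x) (y - g *: B y) g0.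
have := B_coco x y; rewrite -(ler_pM2l g0) mulrA.
have -> : resolvent g A (x - g *: B x) = x - res g x by rewrite subKr.
have -> : resolvent g A (y - g *: B y) = y - res g y by rewrite subKr.
move: (res g x) (res g y) => q r; move: (`|B x - B y| ^+ 2) => e.
rewrite -dotxx !dotE (dotC r q) (dotC q x) (dotC r x) (dotC q y) (dotC r y) (dotC y x).
lra.
Qed.

(** Young's inequality g <q, e> <= g beta |e|^2 + g/(4 beta) |q|^2 eliminates e
    from the key inequality. The constant is 1/(2 alpha). *)
Lemma fb_residual_cocoercive g x y : 0 < g ->
  (1 - g / (4 * beta)) * `|res g x - res g y| ^+ 2 <=
  dot (x - y) (res g x - res g y).
Proof.
move=> g0; apply: le_trans (fb_residual_firm x y g0).
move: (res g x - res g y) (B x - B y) => q e.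
have : 0 <= dot (q - (2 * beta) *: e) (q - (2 * beta) *: e).
  by rewrite dotxx sqr_ge0.
rewrite !dotE !dotxx (dotC e q) => sq.
have gb : 0 < g / (4 * beta) by rewrite divr_gt0 ?mulr_gt0.
rewrite -subr_ge0; move: sq; rewrite -(pmulr_rge0 _ gb) => sq.
apply: le_trans sq _; rewrite le_eqVlt; apply/orP; left; apply/eqP.
by field; rewrite gt_eqF.
Qed.

(** Since g < 2 beta, the cocoercivity constant is at least 1/2. *)
Lemma fb_residual_bound g x y : 0 < g < 2 * beta ->
  `|res g x - res g y| <= 2 * `|x - y|.
Proof.
move=> /andP[g0 g2]; have -> : 2 * `|x - y| = `|2 *: (x - y)|.
  by rewrite normrZ ger0_norm.
apply: le_norm_of_dot.
have := fb_residual_cocoercive x y g0.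
have : 1 / 2 <= 1 - g / (4 * beta).
  by rewrite lerBrDr -lerBrDl ler_pdivrMr ?mulr_gt0 //; lra.
rewrite dotZr dotC; have := sqr_ge0 `|res g x - res g y|; nra.
Qed.

(** Exact relaxed steps do not increase the residual: with q = r_g x and z the
    residual after the step, cocoercivity gives
    <-lam q, z - q> >= lam/2 |z - q|^2, that is |z|^2 <= |q|^2. *)
Lemma fb_residual_relax g lam x : 0 < g -> 0 < lam <= 2 - g / (2 * beta) ->
  `|res g (x - lam *: res g x)| <= `|res g x|.
Proof.
move=> g0 /andP[l0 l1].
have := fb_residual_cocoercive (x - lam *: res g x) x g0.
move: (res g x) (res g _) => q z.
rewrite [x - _ - x]addrC addKr.
have -> : 1 - g / (4 * beta) = (2 - g / (2 * beta)) / 2.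
  by field; rewrite gt_eqF.
rewrite -dotxx !dotE !dotxx (dotC z q) => h.
rewrite -(@ler_pXn2r _ 2) ?nnegrE // -subr_ge0 -(pmulr_rge0 _ l0).
have := sqr_ge0 `|z - q|; rewrite -dotxx !dotE !dotxx (dotC z q) => h2.
nra.
Qed.

(** For xs in Omega, the pairs (xs, - B xs) and (T_g xs, (y - T_g xs)/g), with
    y = xs - g B xs, both lie in the graph of A; monotonicity between them
    forces T_g xs = xs. *)
Lemma fb_residual_zero g xs : 0 < g -> op_zeros (op_add A B) xs -> res g xs = 0.
Proof.
move=> g0 [u Au uB]; have {uB} uB : u = - B xs by apply/eqP; rewrite -addr_eq0 uB.
have [Am _] := A_max.
set y := xs - g *: B xs.
have := Am _ _ _ _ Au (resolventP y g0).
have -> : u = g^-1 *: (y - xs).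
  by rewrite /y addrC addKr -scalerN scalerA mulVf ?gt_eqF // scale1r.
rewrite -scalerBr dotZr pmulr_rge0 ?invr_gt0 //.
rewrite -/(res g xs) /fb_residual -/y; set p := resolvent g A y.
have -> : y - xs - (y - p) = - (xs - p).
  by move: y p => y p; rewrite !opprB addrC addrA subrK.
rewrite dotNr dotxx oppr_ge0 => h.
by apply/eqP; rewrite -normr_eq0 -sqrf_eq0 eq_le h sqr_ge0.
Qed.

Lemma zero_fb_residual g xs : 0 < g -> res g xs = 0 -> op_zeros (op_add A B) xs.
Proof.
move=> g0 /eqP; rewrite subr_eq0 => /eqP r.
exists (- B xs); last by rewrite addNr.
have := resolventP (xs - g *: B xs) g0; rewrite -r.
by rewrite addrC addKr -scalerN scalerA mulVf ?gt_eqF // scale1r.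
Qed.

Lemma fb_relax_fejer g lam x xs : 0 < g -> 0 <= lam ->
  op_zeros (op_add A B) xs ->
  `|x - lam *: res g x - xs| ^+ 2 <=
  `|x - xs| ^+ 2 - lam * (2 - g / (2 * beta) - lam) * `|res g x| ^+ 2.
Proof.
move=> g0 l0 /(fb_residual_zero g0) xs0.
have := fb_residual_cocoercive x xs g0; rewrite xs0 subr0 => h.
have -> : x - lam *: res g x - xs = (x - xs) - lam *: res g x by rewrite addrAC.
have -> : 2 - g / (2 * beta) = 2 * (1 - g / (4 * beta)).
  by field; rewrite gt_eqF.
move: (x - xs) (res g x) h => d q h; rewrite -dotxx !dotE !dotxx (dotC _ d); nra.
Qed.

(** Dependence on the step size: both T_g x and T_g' x are resolvent points
    for the same forward value B x, which cancels in the monotonicity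
    inequality between them. *)
Lemma fb_residual_index g g' x : 0 < g -> 0 < g' ->
  `|res g x - res g' x| <= `|g' - g| / g' * `|res g' x|.
Proof.
move=> g0 g'0; have [Am _] := A_max.
have -> : `|g' - g| / g' * `|res g' x| = `|((g - g') / g') *: res g' x|.
  by rewrite distrC normrZ normrM normfV (gtr0_norm g'0).
apply: le_norm_of_dot.
have := Am _ _ _ _ (resolventP (x - g *: B x) g0) (resolventP (x - g' *: B x) g'0).
have -> : resolvent g A (x - g *: B x) = x - res g x by rewrite subKr.
have -> : resolvent g' A (x - g' *: B x) = x - res g' x by rewrite subKr.
move: (res g x) (res g' x) => q q'.
have e h r : 0 < h -> h^-1 *: (x - h *: B x - (x - r)) = h^-1 *: r - B x.
  move=> h0; rewrite opprB addrC addrA subrK scalerBr scalerA.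
  by rewrite mulVf ?gt_eqF // scale1r.
rewrite !e //.
have -> : x - q - (x - q') = q' - q by rewrite opprB addrC addrA subrK.
have -> : g^-1 *: q - B x - (g'^-1 *: q' - B x) = g^-1 *: q - g'^-1 *: q'.
  by rewrite opprB addrA subrK.
have -> : g^-1 *: q - g'^-1 *: q' = g^-1 *: (q - (g / g') *: q').
  by rewrite scalerBr scalerA mulrA mulVf ?gt_eqF // mul1r.
rewrite (dotZr _ g^-1) pmulr_rge0 ?invr_gt0 // -dotxx.
have -> : (g - g') / g' = g / g' - 1 by field; rewrite gt_eqF.
by move: (g / g') => c; rewrite !dotE (dotC q' q); nra.
Qed.

End ForwardBackward.

(** * Sequences of reals with bounded sums *)
Section RealSequences.
Variable R : realType.
Implicit Types u e w : nat -> R.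

(** Summability of a nonnegative sequence, stated on finite sums so that the
    estimates stay in the reals. *)
Definition bounded_sums u := exists M, forall n, \sum_(0 <= k < n) u k <= M.

Lemma nneseries_bounded_sums u : (forall k, 0 <= u k) ->
  (\sum_(0 <= k <oo) (u k)%:E < +oo)%E <-> bounded_sums u.
Proof.
move=> u0; have u0E n : (0 <= n)%N -> true -> (0 <= (u n)%:E)%E.
  by rewrite lee_fin.
split=> [ufin|[M uM]].
  exists (fine (\sum_(0 <= k <oo) (u k)%:E)%E) => n.
  rewrite -lee_fin fineK ?ge0_fin_numE ?nneseries_ge0 //.
  by rewrite -sumEFin; exact: nneseries_lim_ge.
apply: (@le_lt_trans _ _ M%:E); last exact: ltry.
apply: lime_le; first exact: is_cvg_nneseries.
by apply: nearW => n; rewrite sumEFin lee_fin.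
Qed.

Lemma bounded_sumsZ c u : 0 <= c -> bounded_sums u ->
  bounded_sums (fun k => c * u k).
Proof.
by move=> c0 [M uM]; exists (c * M) => n; rewrite -mulr_sumr ler_wpM2l.
Qed.

Lemma bounded_sumsD u w : bounded_sums u -> bounded_sums w ->
  bounded_sums (fun k => u k + w k).
Proof.
by move=> [M uM] [N wN]; exists (M + N) => n; rewrite big_split lerD.
Qed.

Lemma eventually_le_bounded_sums u w :
  (forall k, 0 <= w k) -> (\forall k \near \oo, u k <= w k) ->
  bounded_sums w -> bounded_sums u.
Proof.
move=> w0 [N _ uw] [M wM]; exists (\sum_(0 <= k < N) `|u k| + M) => n.
have M0 : 0 <= M by have := wM 0%N; rewrite big_geq.
have [nN|/ltnW Nn] := leqP n N.
  rewrite (big_cat_nat (leq0n n) nN) //= -[X in X <= _]addr0 -[_ + _ + M]addrA lerD //.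
    by apply: ler_sum => k _; exact: ler_norm.
  by rewrite addr_ge0 // sumr_ge0.
rewrite (big_cat_nat (leq0n N) Nn) //= lerD //.
  by apply: ler_sum => k _; exact: ler_norm.
apply: le_trans (wM n); rewrite (big_cat_nat (leq0n N) Nn) //= ler_wpDl ?sumr_ge0 //.
by apply: ler_sum_nat => k /andP[Nk _]; exact: uw.
Qed.

Lemma bounded_sums_bounded u : (forall k, 0 <= u k) -> bounded_sums u ->
  exists M, forall k, u k <= M.
Proof.
move=> u0 [M uM]; exists M => k; apply: le_trans (uM k.+1).
by rewrite big_nat_recr //= lerDr sumr_ge0.
Qed.

Lemma bounded_sums_cvg u : (forall k, 0 <= u k) -> bounded_sums u ->
  cvg (series u @ \oo).
Proof.
move=> u0 [M uM]; apply: nondecreasing_is_cvgn.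
  by apply/nondecreasing_seqP => n; rewrite seriesSr lerDl.
by exists M => _ [n _ <-]; exact: uM.
Qed.

Lemma bounded_sums_cvg0 u : (forall k, 0 <= u k) -> bounded_sums u ->
  u @ \oo --> (0 : R).
Proof. by move=> u0 /(bounded_sums_cvg u0)/cvg_series_cvg_0. Qed.

(** Subtracting the partial sums of e makes u nonincreasing. *)
Lemma quasi_nonincreasing_cvg u e : (forall k, 0 <= u k) ->
  (forall k, 0 <= e k) -> bounded_sums e ->
  (forall k, u k.+1 <= u k + e k) -> cvg (u @ \oo).
Proof.
move=> u0 e0 eb ue; have [M eM] := eb.
have -> : u = (fun n => u n - series e n) \+ series e.
  by apply/funext => n /=; rewrite subrK.
apply: is_cvgD; last exact: bounded_sums_cvg.
apply: nonincreasing_is_cvgn.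
  by apply/nonincreasing_seqP => n; rewrite seriesSr; have := ue n; lra.
exists (- M) => _ [n _ <-]; have := u0 n; have := eM n; rewrite /series /=; lra.
Qed.

Lemma descent_bounded_sums u w e : (forall k, 0 <= u k) -> bounded_sums e ->
  (forall k, u k.+1 <= u k - w k + e k) -> bounded_sums w.
Proof.
move=> u0 [M eM] uwe; exists (u 0%N + M) => n.
suff : \sum_(0 <= k < n) w k <= u 0%N - u n + \sum_(0 <= k < n) e k.
  by have := eM n; have := u0 n; lra.
elim: n => [|n IHn]; first by rewrite !big_geq // subrr addr0.
by rewrite !big_nat_recr //=; have := uwe n; lra.
Qed.

End RealSequences.

Lemma cvg_norm0_of_sqr (R : realType) (V : normedModType R) (T : Type)
    (F : set_system T) (FF : Filter F) (f : T -> V) :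
  `|f t| ^+ 2 @[t --> F] --> (0 : R) -> `|f t| @[t --> F] --> (0 : R).
Proof.
move=> f0; have -> : (fun t => `|f t|) = fun t => Num.sqrt (`|f t| ^+ 2).
  by apply/funext => t; rewrite sqrtr_sqr normr_id.
rewrite -[X in _ --> X]sqrtr0; apply: continuous_cvg => //.
exact: sqrt_continuous.
Qed.

(** * Ultrafilters and weak compactness *)
Section Ultrafilters.

(** Ultrafilters replace the extraction of subsequences: convergence can be
    tested on them, and bounded real families converge along them. *)
Lemma cvg_ultra (T : Type) (V : topologicalType) (F : set_system T)
    (FF : Filter F) (f : T -> V) (l : V) :
  (forall U, UltraFilter U -> F `<=` U -> f @ U --> l) -> f @ F --> l.
Proof.
move=> fU N lN; apply: contrapT => nFN.
(* If the preimage of a neighbourhood N is not in F, its complement can be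
   adjoined to F. *)
have PW : ProperFilter (within (~` (f @^-1` N)) F).
  split; last exact: within_filter.
  rewrite /within/= => Fn; apply: nFN; apply: filterS Fn => t nt.
  by apply: contrapT => /nt.
have [U [Uu WU]] := ultraFilterLemma PW.
have FU : F `<=` U by move=> S FS; apply: WU; apply: filterS FS => t St _.
have UN : U (f @^-1` N) by apply: fU.
have UnN : U (~` (f @^-1` N)) by apply: WU; exact: withinT.
by have [t []] := filter_ex (filterI UN UnN).
Qed.

Lemma ultra_bounded_cvg (R : realType) (T : Type) (U : set_system T)
    (f : T -> R) (M : R) :
  UltraFilter U -> (forall t, `|f t| <= M) -> cvg (f @ U).
Proof.
move=> Uu fM.
have : (f @ U) `[- M, M]%classic.
  by apply: (filterS (F := U) _ filterT) => t _ /=; rewrite in_itv /= -ler_norml.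
move=> /(segment_compact _) [p [_ fp]]; apply/cvg_ex; exists p => N pN.
have [//|UN] := in_ultra_setVsetC (f @^-1` N) Uu.
by have [y []] := fp (~` N) N UN pN.
Qed.

End Ultrafilters.

Section WeakCompactness.
Variables (R : realType) (H : completeNormedModType R).
Variables (dot : {dot H for idfun}) (dot_norm : induces_norm dot).
Implicit Types (x y z u v w h : H).
Let dotC := dotC dot.
Let dotE := dotE dot.
Let dotxx := dotxx dot_norm.

(** The representing vector minimizes the strongly convex |z|^2 - 2 phi z. *)
Lemma Riesz_representation (phi : H -> R) (M : R) :
  (forall x y, phi (x + y) = phi x + phi y) ->
  (forall c x, phi (c *: x) = c * phi x) ->
  (forall x, `|phi x| <= M * `|x|) ->
  exists w, forall h, phi h = dot w h.
Proof.
move=> phiD phiZ phiM; pose f z := `|z| ^+ 2 - 2 * phi z.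
(* |z|^2 - 2 M |z| = (|z| - M)^2 - M^2. *)
have f_ge z : - M ^+ 2 <= f z.
  have := phiM z; have := ler_norm (phi z); have := sqr_ge0 (`|z| - M).
  by rewrite /f; nra.
have [m [s [mf fs]]] := minimizing_sequence (0 : H) f_ge.
have mid z z' : exists r, f r <= (f z + f z') / 2 - 4^-1 * `|z - z'| ^+ 2.
  exists (2^-1 *: (z + z')); rewrite /f (dot_midpoint dot_norm) phiZ phiD; lra.
have c0 : 0 < 4^-1 :> R by rewrite invr_gt0.
have /cvg_ex[/= w sw] := minimizing_sequence_cvg (p := id) c0 mf fs mid.
have phis : phi \o s @ \oo --> phi w.
  apply/cvgrPdist_le => e e0.
  have M0 : 0 < `|M| + 1 by rewrite ltr_wpDl.
  move/cvgrPdist_le: sw => /(_ (e / (`|M| + 1))); rewrite divr_gt0 // => /(_ isT).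
  apply: filterS => n; rewrite ler_pdivlMr //= => wsn.
  have -> : phi w - phi (s n) = phi (w - s n).
    by rewrite phiD -[- s n]scaleN1r phiZ mulN1r.
  apply: le_trans (phiM _) (le_trans _ wsn); rewrite mulrC ler_wpM2l //.
  by have := ler_norm M; lra.
have fw : f w = m.
  apply: (cvg_unique (@norm_hausdorff R R^o) _ fs) => //.
  apply: cvgB; first by apply: cvg_sqr; exact: cvg_norm.
  by apply: cvgMl_tmp.
have slope h : 0 <= dot w h - phi h.
  suff : 0 <= 2 * (dot w h - phi h) by rewrite pmulr_rge0.
  apply: (@quadratic_ge0_slope _ _ (`|h| ^+ 2)) => c _.
  have := mf (w + c *: h); rewrite -fw /f phiD phiZ -!dotxx !dotE (dotC h w); lra.
exists w => h; have := slope h; have := slope (- h).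
by rewrite dotNr -[- h]scaleN1r phiZ; lra.
Qed.

(** The limits of the scalar products define a bounded linear form. *)
Lemma ultra_weak_cvg (T : Type) (U : set_system T) (x : T -> H) (M : R) :
  UltraFilter U -> (forall t, `|x t| <= M) ->
  exists w, forall h, dot (x t) h @[t --> U] --> dot w h.
Proof.
move=> Uu xM; have cv h : cvg (dot (x t) h @[t --> U]).
  apply: (ultra_bounded_cvg (M := M * `|h|)) => t.
  by apply: le_trans (Cauchy_Schwarz dot_norm _ _) _; rewrite ler_wpM2r.
pose phi h : R := lim (dot (x t) h @[t --> U]).
have phiP h : dot (x t) h @[t --> U] --> phi h by exact: cv.
have phi_eq h l : dot (x t) h @[t --> U] --> l -> phi h = l.
  by move=> hl; apply: (cvg_unique (@norm_hausdorff R R^o) (phiP h) hl).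
have [w phiw] : exists w, forall h, phi h = dot w h.
  apply: (@Riesz_representation phi M).
  - move=> y z; apply: phi_eq; under eq_fun do rewrite dotDr.
    by apply: cvgD; exact: phiP.
  - move=> c y; apply: phi_eq; under eq_fun do rewrite dotZr.
    by apply: cvgMl_tmp; exact: phiP.
  - move=> y; apply: (cvgr_to_le (cvg_norm (phiP y))); apply: nearW => t.
    by apply: le_trans (Cauchy_Schwarz dot_norm _ _) _; rewrite ler_wpM2r.
by exists w => h; rewrite -phiw.
Qed.

(** Opial's argument: for w and v in S the difference of the squared distances
    is affine in the iterate, so <x_k, w - v> converges along the whole
    sequence. If w and v are weak limits along two ultrafilters, this limit is
    both <w, w - v> and <v, w - v>. *)
Lemma Opial_weak_cvg (x : nat -> H) (S : set H) (M : R) : (forall k, `|x k| <= M) ->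
  (forall z, S z -> cvg (`|x k - z| @[k --> \oo])) ->
  (forall U w, UltraFilter U -> \oo `<=` U ->
    (forall h, dot (x k) h @[k --> U] --> dot w h) -> S w) ->
  exists2 w, S w & weakly_cvg dot x w.
Proof.
move=> xM xS Scl.
have [U [Uu oU]] := ultraFilterLemma (F := \oo) _.
have [w Uw] := ultra_weak_cvg Uu xM; have Sw := Scl _ _ Uu oU Uw.
exists w => // h; apply: cvg_ultra => V Vu oV.
have [v Vv] := ultra_weak_cvg Vu xM; have Sv := Scl _ _ Vu oV Vv.
suff -> : w = v by [].
have /cvg_ex[/= l wl] := xS _ Sw; have /cvg_ex[/= r vr] := xS _ Sv.
have diff : dot (x k) (w - v) @[k --> \oo] -->
    (`|w| ^+ 2 - `|v| ^+ 2 - (l ^+ 2 - r ^+ 2)) / 2.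
  have -> : (fun k => dot (x k) (w - v)) = (fun k =>
      (`|w| ^+ 2 - `|v| ^+ 2 - (`|x k - w| ^+ 2 - `|x k - v| ^+ 2)) / 2).
    apply/funext => k; rewrite -!dotxx !dotE (dotC w) (dotC v); lra.
  by apply: cvgMr_tmp; apply: cvgB; [exact: cvg_cst | apply: cvgB; exact: cvg_sqr].
have dotUV : dot w (w - v) = dot v (w - v).
  have dU := cvg_trans (cvg_app _ oU) diff; have dV := cvg_trans (cvg_app _ oV) diff.
  rewrite (cvg_unique (@norm_hausdorff R R^o) (Uw (w - v)) dU).
  by rewrite (cvg_unique (@norm_hausdorff R R^o) (Vv (w - v)) dV).
apply/eqP; rewrite -subr_eq0 -normr_eq0 -sqrf_eq0 -dotxx.
by rewrite dotDl dotNl dotUV subrr.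
Qed.

End WeakCompactness.

(** * Cocoercive operators and demiclosedness *)
Section Demiclosed.
Variables (R : realType) (H : completeNormedModType R).
Variables (dot : {dot H for idfun}) (dot_norm : induces_norm dot).
Variables (A : H -> set H) (A_max : maximal_monotone dot A).
Variables (B : H -> H) (beta : R) (beta_gt0 : 0 < beta).
Variable (B_coco : cocoercive dot beta B).
Implicit Types (x y z u v w : H) (g : R).
Let dotC := dotC dot.
Let dotE := dotE dot.
Let dotxx := dotxx dot_norm.
Local Notation res := (fb_residual A B).

Lemma cocoercive_monotone x y : 0 <= dot (x - y) (B x - B y).
Proof.
by apply: le_trans (B_coco x y); rewrite mulr_ge0 ?sqr_ge0 // ltW.
Qed.

Lemma cocoercive_lipschitz x y : `|B x - B y| <= beta^-1 * `|x - y|.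
Proof.
have -> : beta^-1 * `|x - y| = `|beta^-1 *: (x - y)|.
  by rewrite normrZ gtr0_norm // invr_gt0.
apply: (le_norm_of_dot dot_norm).
by rewrite dotC dotZl -(ler_pM2l beta_gt0) [X in _ <= X]mulrA divff ?gt_eqF // mul1r.
Qed.

Lemma cocoercive_bounded (T : Type) (x : T -> H) M : (forall t, `|x t| <= M) ->
  exists K, forall t, `|B (x t)| <= K.
Proof.
move=> xM; exists (beta^-1 * M + `|B 0|) => t.
rewrite -[B (x t)](subrK (B 0)); apply: le_trans (ler_normD _ _) _.
rewrite lerD2r; apply: le_trans (cocoercive_lipschitz _ _) _.
by rewrite subr0 ler_pM2l // invr_gt0.
Qed.

(** Demiclosedness, with varying step sizes. B x_t need not converge weakly to
    B w, but monotonicity of B lets B x_t be replaced by B z in the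
    inequalities between (x_t - r_t, r_t / g_t - B x_t) and points (z, u) of the
    graph of A; in the limit <w - z, B z + u> <= 0. It is enough to use the
    point z = T_s w: with s < beta the Lipschitz bound 1/beta of B forces
    z = w. *)
Lemma weak_limit_zero (T : Type) (F : set_system T) (FF : ProperFilter F)
    (x : T -> H) (g : T -> R) (gl M : R) w :
  (forall t, `|x t| <= M) -> 0 < gl -> (forall t, gl <= g t) ->
  `|res (g t) (x t)| @[t --> F] --> (0 : R) ->
  (forall h, dot (x t) h @[t --> F] --> dot w h) ->
  op_zeros (op_add A B) w.
Proof.
move=> xM gl0 glg q0 xw; have [Am _] := A_max.
have b20 : 0 < beta / 2 by rewrite divr_gt0.
apply: (zero_fb_residual dot_norm A_max b20).
set z := resolvent (beta / 2) A (w - (beta / 2) *: B w).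
set u := (beta / 2)^-1 *: (w - (beta / 2) *: B w - z).
have Azu : A z u by exact: (resolventP dot_norm A_max).
have [K BK] := cocoercive_bounded xM.
(* The difference with the limit inequality is of the order of the residual;
   gl bounds the factors 1 / g_t. *)
have key t : dot (x t - z) (B z + u) <=
    `|res (g t) (x t)| * (gl^-1 * (M + `|z|) + (K + `|u|)).
  have g0 : 0 < g t by apply: lt_le_trans (glg t).
  have := Am _ _ _ _ (resolventP dot_norm A_max (x t - g t *: B (x t)) g0) Azu.
  have -> : resolvent (g t) A (x t - g t *: B (x t)) = x t - res (g t) (x t).
    by rewrite subKr.
  set q := res (g t) (x t).
  have -> : x t - g t *: B (x t) - (x t - q) = q - g t *: B (x t).
    by rewrite opprB addrC addrA subrK.
  rewrite scalerBr scalerA mulVf ?gt_eqF // scale1r => mono.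
  have coc := cocoercive_monotone (x t) z.
  have b1 : (g t)^-1 * dot (x t - z) q <= `|q| * (gl^-1 * (M + `|z|)).
    apply: (@le_trans _ _ ((g t)^-1 * (`|q| * (M + `|z|)))).
      rewrite ler_pM2l ?invr_gt0 // dotC.
      apply: le_trans (dot_le_norm dot_norm _ _) _; rewrite ler_wpM2l //.
      by apply: le_trans (ler_normB _ _) _; rewrite lerD2r.
    rewrite mulrCA ler_wpM2l // ler_wpM2r //.
      by rewrite addr_ge0 // (le_trans _ (xM t)).
    by rewrite lef_pV2 ?posrE.
  have b2 : dot q (B (x t) + u) <= `|q| * (K + `|u|).
    apply: le_trans (dot_le_norm dot_norm _ _) _; rewrite ler_wpM2l //.
    by apply: le_trans (ler_normD _ _) _; rewrite lerD2r.
  have b3 : 0 <= (g t)^-1 * dot q q.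
    by rewrite dotxx mulr_ge0 ?sqr_ge0 // invr_ge0 ltW.
  move: (x t) q (B (x t)) mono coc b1 b2 b3 => y q By.
  by rewrite mulrDr !dotE; lra.
have le0 : dot (w - z) (B z + u) <= 0.
  set K' := gl^-1 * (M + `|z|) + (K + `|u|) in key.
  have lim0 : dot (x t - z) (B z + u) - `|res (g t) (x t)| * K' @[t --> F]
      --> dot (w - z) (B z + u) - 0 * K'.
    apply: cvgB; last exact: cvgMr_tmp.
    under eq_fun do rewrite dotDl; rewrite dotDl.
    by apply: cvgD; [exact: xw | exact: cvg_cst].
  rewrite -[X in X <= _]subr0 -[X in _ - X](mul0r K').
  by apply: (cvgr_to_le lim0); apply: nearW => t; rewrite subr_le0.
have uE : u = (beta / 2)^-1 *: (w - z) - B w.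
  by rewrite /u addrAC scalerBr scalerA mulVf ?gt_eqF // scale1r.
suff : w - z = 0 by [].
clearbody u; clearbody z.
have lip := le_trans (dot_le_norm dot_norm (w - z) (B w - B z))
  (ler_wpM2l (normr_ge0 _) (cocoercive_lipschitz w z)).
have d0 : beta^-1 * `|w - z| ^+ 2 <= 0.
  have b2 : (beta / 2)^-1 = 2 * beta^-1 by field; rewrite gt_eqF.
  move: le0 lip; rewrite uE b2; move: (w - z) => d.
  by rewrite !dotE dotxx expr2; lra.
apply/eqP; rewrite -normr_eq0 -sqrf_eq0 eq_le sqr_ge0 andbT.
by move: d0; rewrite pmulr_rle0 ?invr_gt0.
Qed.

End Demiclosed.

(** * The inexact relaxed iteration *)
Section Iteration.
Variables (R : realType) (H : completeNormedModType R).
Variables (dot : {dot H for idfun}) (dot_norm : induces_norm dot).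
Variables (A : H -> set H) (A_max : maximal_monotone dot A).
Variables (B : H -> H) (beta : R) (beta_gt0 : 0 < beta).
Variable (B_coco : cocoercive dot beta B).
Variables (gam lam : nat -> R) (a b x : nat -> H).
Hypothesis gam_range : forall k, 0 < gam k < 2 * beta.
Hypothesis lam_range : forall k, 0 < lam k < 2 - gam k / (2 * beta).
Hypothesis a_sum : bounded_sums (fun k => lam k * `|a k|).
Hypothesis b_sum : bounded_sums (fun k => lam k * `|b k|).
Hypothesis x_rec : forall k, x k.+1 = x k +
  lam k *: (resolvent (gam k) A (x k - gam k *: (B (x k) + b k)) + a k - x k).
Local Notation res := (fb_residual A B).
Local Notation Omega := (op_zeros (op_add A B)).

Let gam0 k : 0 < gam k. Proof. by have /andP[] := gam_range k. Qed.
Let lam0 k : 0 < lam k. Proof. by have /andP[] := lam_range k. Qed.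
Let lamS k : 0 <= lam k * (2 - gam k / (2 * beta) - lam k).
Proof.
by have /andP[l0 lt] := lam_range k; rewrite mulr_ge0 ?subr_ge0 // ltW.
Qed.

(** By nonexpansiveness of the resolvent, b_k enters with the factor gam_k,
    which is at most 2 beta. *)
Definition step_error k := lam k * `|a k| + 2 * beta * (lam k * `|b k|).

Lemma step_error_ge0 k : 0 <= step_error k.
Proof. by rewrite addr_ge0 // !mulr_ge0 // ltW. Qed.

Lemma step_error_sum : bounded_sums step_error.
Proof.
by apply: bounded_sumsD => //; apply: bounded_sumsZ; rewrite // mulr_ge0 // ltW.
Qed.

Lemma inexact_step k :
  `|x k.+1 - (x k - lam k *: res (gam k) (x k))| <= step_error k.
Proof.
rewrite x_rec /fb_residual.
set p := resolvent _ _ _; set q := resolvent _ _ (_ - gam k *: B _).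
have -> : x k + lam k *: (p + a k - x k) - (x k - lam k *: (x k - q)) =
    lam k *: (a k + (p - q)).
  rewrite opprB addrC addrA subrK -scalerDr; congr (_ *: _).
  by rewrite addrC addrA subrK [p + _]addrC addrA.
rewrite normrZ gtr0_norm // /step_error mulrCA -mulrDr ler_wpM2l ?(ltW (lam0 k)) //.
apply: le_trans (ler_normD _ _) _; rewrite lerD2l.
apply: le_trans (resolvent_nonexpansive dot_norm A_max _ _ (gam0 k)) _.
have -> : x k - gam k *: (B (x k) + b k) - (x k - gam k *: B (x k)) =
    - (gam k *: b k).
  by rewrite opprB addrC addrA subrK -scalerBr opprD addrA subrr add0r scalerN.
rewrite normrN normrZ gtr0_norm // ler_wpM2r //.
by have /andP[_ /ltW] := gam_range k.
Qed.

Lemma quasi_fejer xs k : Omega xs ->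
  `|x k.+1 - xs| <= `|x k - xs| + step_error k.
Proof.
move=> xsO; pose z := x k - lam k *: res (gam k) (x k).
have -> : x k.+1 - xs = (z - xs) + (x k.+1 - z) by rewrite [RHS]addrC subrKA.
apply: le_trans (ler_normD _ _) (lerD _ (inexact_step k)).
have := fb_relax_fejer dot_norm A_max beta_gt0 B_coco (x k) (gam0 k)
  (ltW (lam0 k)) xsO.
rewrite -/z => zx; rewrite -(@ler_pXn2r _ 2) ?nnegrE //.
apply: le_trans zx _; rewrite gerBl.
by rewrite mulr_ge0 ?sqr_ge0.
Qed.

Lemma dist_cvg xs : Omega xs -> cvg (`|x k - xs| @[k --> \oo]).
Proof.
move=> xsO; apply: quasi_nonincreasing_cvg step_error_ge0 step_error_sum _ => //.
by move=> k; exact: quasi_fejer.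
Qed.

Lemma dist_bounded xs : Omega xs -> exists M, forall k, `|x k - xs| <= M.
Proof.
move=> xsO; have [E sE] := step_error_sum; exists (`|x 0%N - xs| + E) => k.
apply: le_trans (_ : `|x 0%N - xs| + \sum_(0 <= j < k) step_error j <= _).
  elim: k => [|k IHk]; first by rewrite big_geq // addr0.
  by rewrite big_nat_recr //= addrA; have := quasi_fejer k xsO; lra.
by rewrite lerD2l.
Qed.

(** Squaring the perturbed Fejer inequality costs a multiple of step_error, as
    the distances to a zero are bounded. *)
Lemma residual_sum : Omega !=set0 -> bounded_sums (fun k =>
  lam k * (2 - gam k / (2 * beta) - lam k) * `|res (gam k) (x k)| ^+ 2).
Proof.
move=> [xs xsO]; have [M xM] := dist_bounded xsO.
have [K eK] := bounded_sums_bounded step_error_ge0 step_error_sum.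
apply: (@descent_bounded_sums _ (fun k => `|x k - xs| ^+ 2) _
  (fun k => (2 * M + K) * step_error k)); first by move=> k; rewrite sqr_ge0.
  apply: bounded_sumsZ step_error_sum; rewrite addr_ge0 ?mulr_ge0 //.
    exact: le_trans (xM 0%N).
  exact: le_trans (step_error_ge0 0%N) (eK 0%N).
move=> k; pose z := x k - lam k *: res (gam k) (x k).
have zx : `|z - xs| ^+ 2 <= _ := fb_relax_fejer dot_norm A_max beta_gt0 B_coco
  (x k) (gam0 k) (ltW (lam0 k)) xsO.
have xz : `|x k.+1 - xs| <= `|z - xs| + step_error k.
  have -> : x k.+1 - xs = (z - xs) + (x k.+1 - z) by rewrite [RHS]addrC subrKA.
  exact: le_trans (ler_normD _ _) (lerD (lexx _) (inexact_step k)).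
have zM : `|z - xs| <= M.
  rewrite -(@ler_pXn2r _ 2) ?nnegrE //; last exact: le_trans (xM 0%N).
  apply: le_trans zx _; apply: (@le_trans _ _ (`|x k - xs| ^+ 2)).
    by rewrite gerBl mulr_ge0 ?sqr_ge0.
  by rewrite ler_pXn2r ?nnegrE //; exact: le_trans (xM 0%N).
apply: (@le_trans _ _ ((`|z - xs| + step_error k) ^+ 2)).
  by rewrite ler_pXn2r ?nnegrE // addr_ge0 // step_error_ge0.
have := eK k; have := step_error_ge0 k; have := normr_ge0 (z - xs); nra.
Qed.

(** Three changes lead from r_{g_k}(x_k) to r_{g_(k+1)}(x_(k+1)): the exact step,
    which does not increase the norm; the error, through the 2-Lipschitz
    residual; and the change of step size. *)
Lemma residual_quasi_nonincreasing gl : Omega !=set0 -> 0 < gl ->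
  (forall k, gl <= gam k) -> exists C, [/\ 0 <= C & forall k,
  `|res (gam k.+1) (x k.+1)| <= `|res (gam k) (x k)|
     + (2 * step_error k + C * `|gam k.+1 - gam k|)].
Proof.
move=> [xs xsO] gl0 glg; have [M xM] := dist_bounded xsO.
have M0 : 0 <= M by exact: le_trans (xM 0%N).
exists (gl^-1 * (2 * M)); split => [|k]; first by rewrite !mulr_ge0 // invr_ge0 ltW.
pose z := x k - lam k *: res (gam k) (x k).
have bound y y' : `|res (gam k) y - res (gam k) y'| <= 2 * `|y - y'|.
  exact: (fb_residual_bound dot_norm A_max beta_gt0 B_coco y y' (gam_range k)).
have rz : `|res (gam k) z| <= `|res (gam k) (x k)|.
  have /andP[l0 l1] := lam_range k.
  by apply: (fb_residual_relax dot_norm A_max beta_gt0 B_coco) => //; rewrite l0 ltW.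
have r1 : `|res (gam k) (x k.+1)| <= `|res (gam k) (x k)| + 2 * step_error k.
  rewrite -[res _ (x k.+1)](subrK (res (gam k) z)) addrC.
  apply: le_trans (ler_normD _ _) (lerD rz _); apply: le_trans (bound _ _) _.
  by rewrite ler_pM2l // inexact_step.
have r2 : `|res (gam k) (x k.+1)| <= 2 * M.
  have := bound (x k.+1) xs.
  rewrite (fb_residual_zero dot_norm A_max (gam0 k) xsO) subr0.
  by have := xM k.+1; lra.
have r3 : `|res (gam k.+1) (x k.+1) - res (gam k) (x k.+1)| <=
    gl^-1 * (2 * M) * `|gam k.+1 - gam k|.
  apply: le_trans (fb_residual_index dot_norm A_max B _ (gam0 _) (gam0 k)) _.
  rewrite distrC -mulrA mulrC ler_wpM2r // ler_pM ?invr_ge0 ?(ltW (gam0 k)) //.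
  by rewrite lef_pV2 ?posrE.
have := ler_normD (res (gam k.+1) (x k.+1) - res (gam k) (x k.+1))
  (res (gam k) (x k.+1)).
by rewrite subrK; lra.
Qed.

Lemma residual_cvg0_of_gap l tau : Omega !=set0 -> 0 < l -> 0 < tau ->
  (forall k, l <= lam k) -> (forall k, lam k <= 2 - gam k / (2 * beta) - tau) ->
  `|res (gam k) (x k)| @[k --> \oo] --> (0 : R).
Proof.
move=> O0 l0 t0 llam lamt.
have lt0 : 0 < l * tau by rewrite mulr_gt0.
apply: cvg_norm0_of_sqr; apply: bounded_sums_cvg0 => [k|]; first exact: sqr_ge0.
have [M rM] := residual_sum O0; exists ((l * tau)^-1 * M) => n.
rewrite -(ler_pM2l lt0) mulVKf ?gt_eqF // mulr_sumr.
apply: le_trans (rM n); apply: ler_sum => k _.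
rewrite ler_wpM2r ?sqr_ge0 // ler_pM ?(ltW l0) ?(ltW t0) //.
by have := lamt k; lra.
Qed.

(** The norms of the residuals converge; a positive limit would make the
    weights themselves summable, by the summability of the gains. *)
Lemma residual_cvg0_of_divergence gl : Omega !=set0 -> 0 < gl ->
  (forall k, gl <= gam k) ->
  ~ bounded_sums (fun k => lam k * (2 - gam k / (2 * beta) - lam k)) ->
  bounded_sums (fun k => `|gam k.+1 - gam k|) ->
  `|res (gam k) (x k)| @[k --> \oo] --> (0 : R).
Proof.
move=> O0 gl0 glg div gsum.
have [C [C0 rC]] := residual_quasi_nonincreasing O0 gl0 glg.
have /cvg_ex[/= L rL] : cvg (`|res (gam k) (x k)| @[k --> \oo]).
  apply: (quasi_nonincreasing_cvg _ _ _ rC) => // [k|].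
    by rewrite addr_ge0 ?mulr_ge0 // step_error_ge0.
  apply: bounded_sumsD; apply: bounded_sumsZ => //; exact: step_error_sum.
have L0 : 0 <= L by apply: (cvgr_to_ge rL); exact: nearW.
have [<- //|Lneq0] := eqVneq L 0.
have Lpos : 0 < L / 2 by rewrite divr_gt0 // lt0r Lneq0.
have L2 : 0 < (L / 2) ^+ 2 by rewrite exprn_gt0.
exfalso; apply: div.
apply: (@eventually_le_bounded_sums _ _ (fun k => (L / 2) ^- 2 *
  (lam k * (2 - gam k / (2 * beta) - lam k) * `|res (gam k) (x k)| ^+ 2))).
- by move=> k; rewrite mulr_ge0 ?invr_ge0 ?(ltW L2) // mulr_ge0 ?sqr_ge0.
- move/cvgrPdist_lt: rL => /(_ _ Lpos); apply: filterS => k Lk.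
  rewrite mulrCA ler_peMr // ler_pdivlMl // mulr1.
  rewrite ler_pXn2r ?nnegrE ?(ltW Lpos) //.
  by have := le_lt_trans (ler_norm _) Lk; lra.
by apply: bounded_sumsZ (residual_sum O0); rewrite invr_ge0 ltW.
Qed.

Lemma iterates_bounded : Omega !=set0 -> exists M, forall k, `|x k| <= M.
Proof.
move=> [xs xsO]; have [M xM] := dist_bounded xsO.
exists (M + `|xs|) => k; rewrite -[x k](subrK xs).
by apply: le_trans (ler_normD _ _) _; rewrite lerD2r.
Qed.

Lemma iterates_weakly_cvg gl : Omega !=set0 -> 0 < gl ->
  (forall k, gl <= gam k) ->
  `|res (gam k) (x k)| @[k --> \oo] --> (0 : R) ->
  exists2 xs, Omega xs & weakly_cvg dot x xs.
Proof.
move=> O0 gl0 glg r0; have [M xM] := iterates_bounded O0.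
apply: (Opial_weak_cvg dot_norm xM dist_cvg) => U w Uu oU xw.
apply: (@weak_limit_zero _ _ _ dot_norm _ A_max _ _ beta_gt0 B_coco nat U _ x gam
  gl M w) => //.
exact: cvg_trans (cvg_app _ oU) r0.
Qed.

(** At y = x*, where the residual vanishes, the key inequality reads
    |q|^2 + g beta |e|^2 <= <d, q> + g <q, e>, with d and e bounded and q the
    residual. *)
Lemma forward_values_cvg gl xs : Omega xs -> 0 < gl ->
  (forall k, gl <= gam k) ->
  `|res (gam k) (x k)| @[k --> \oo] --> (0 : R) ->
  B (x k) @[k --> \oo] --> B xs.
Proof.
move=> xsO gl0 glg r0; have [M xM] := dist_bounded xsO.
have glb : 0 < gl * beta by rewrite mulr_gt0.
pose K := (gl * beta)^-1 * (M + 2 * M).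
have bound k : `|B (x k) - B xs| ^+ 2 <= `|res (gam k) (x k)| * K.
  have firm := fb_residual_firm dot_norm A_max B_coco (x k) xs (gam0 k).
  move: firm; rewrite (fb_residual_zero dot_norm A_max (gam0 k) xsO) subr0.
  move: (res (gam k) (x k)) => q firm.
  have lip := cocoercive_lipschitz dot_norm beta_gt0 B_coco (x k) xs.
  have c1 := dot_le_norm dot_norm (x k - xs) q.
  have c2 := dot_le_norm dot_norm q (B (x k) - B xs).
  have d1 : `|x k - xs| * `|q| <= M * `|q| by rewrite ler_wpM2r.
  have d2 : gam k * dot q (B (x k) - B xs) <= 2 * M * `|q|.
    apply: (@le_trans _ _ (2 * beta * (`|q| * (beta^-1 * M)))).
      have /andP[_ g2] := gam_range k.
      apply: (@le_trans _ _ (gam k * (`|q| * (beta^-1 * M)))).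
        rewrite ler_pM2l //; apply: le_trans c2 _; rewrite ler_wpM2l //.
        by apply: le_trans lip _; rewrite ler_pM2l ?invr_gt0.
      rewrite ler_wpM2r ?(ltW g2) // !mulr_ge0 // ?invr_ge0 ?(ltW beta_gt0) //.
      exact: le_trans (xM 0%N).
    rewrite le_eqVlt; apply/orP; left; apply/eqP; field; exact: lt0r_neq0.
  have d3 : gl * beta * `|B (x k) - B xs| ^+ 2 <=
      gam k * beta * `|B (x k) - B xs| ^+ 2.
    by rewrite ler_wpM2r ?sqr_ge0 // ler_pM2r.
  rewrite -(ler_pM2l glb) [X in _ <= X]mulrCA /K mulVKf ?gt_eqF //.
  by have := sqr_ge0 `|q|; lra.
apply/subr_cvg0; apply: norm_cvg0; apply: cvg_norm0_of_sqr.
apply: (squeeze_cvgr (f := cst 0) (h := fun k => `|res (gam k) (x k)| * K)).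
- by apply: nearW => k; rewrite bound sqr_ge0.
- exact: cvg_cst.
by rewrite -[X in _ --> X](mul0r K); exact: cvgMr_tmp.
Qed.

End Iteration.

Theorem corollary3p3 (R : realType) (H : completeNormedModType R)
    (dot : {dot H for idfun}) (dot_norm : induces_norm dot)
    (A : H -> set H) (A_max : maximal_monotone dot A)
    (B : H -> H) (beta : R) (beta_gt0 : 0 < beta)
    (B_coco : cocoercive dot beta B)
    (Omega : set H) (Omega_def : Omega = op_zeros (op_add A B))
    (Omega_neq0 : Omega !=set0)
    (gam lam alpha : nat -> R)
    (gam_range : forall k, 0 < gam k < 2 * beta)
    (alpha_def : forall k, alpha k = 2 * beta / (4 * beta - gam k))
    (lam_range : forall k, 0 < lam k < 1 / alpha k)
    (a b : nat -> H)
    (a_sum : (\sum_(0 <= k <oo) (lam k * `|a k|)%:E < +oo)%E)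
    (b_sum : (\sum_(0 <= k <oo) (lam k * `|b k|)%:E < +oo)%E)
    (x y : nat -> H) (x0 : H) (x_init : x 0%N = x0)
    (y_def : forall k, y k = x k - gam k *: (B (x k) + b k))
    (x_rec : forall k,
      x k.+1 = x k + lam k *: (resolvent (gam k) A (y k) + a k - x k)) :
  (forall xs, Omega xs -> cvg ((fun k => `|x k - xs|) @ \oo)) /\
  (forall lam_low tau gam_low eps : R,
    let a1 := 0 < lam_low /\ forall k, lam_low <= lam k in
    let a2 := forall k, 0 < tau < 1 / alpha k - lam_low /\
                        lam k <= 1 / alpha k - tau in
    let a3 := 0 < gam_low /\ forall k, gam_low <= gam k in
    let a4 := 0 < eps < 2 * beta - gam_low /\
              forall k, gam k <= 2 * beta - eps in
    let a5 :=
      (\sum_(0 <= k <oo) (lam k * (1 / alpha k - lam k))%:E = +oo)%E /\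
      (\sum_(0 <= k <oo) `|gam k.+1 - gam k|%:E < +oo)%E in
    [/\ (a1 /\ a2) \/ [/\ a3, a4 & a5] ->
          (fun k => `|x k - resolvent (gam k) A (x k - gam k *: B (x k))|)
            @ \oo --> (0 : R),
        [/\ a1, a2 & a3] \/ [/\ a3, a4 & a5] ->
          exists2 xs, Omega xs & weakly_cvg dot x xs
      & [/\ a1, a2 & a3] \/ [/\ a1, a3, a4 & a5] ->
          forall xs, Omega xs -> (fun k => B (x k)) @ \oo --> B xs]).
Proof.
have b20 : 0 < 2 * beta by rewrite mulr_gt0.
have alphaE k : 1 / alpha k = 2 - gam k / (2 * beta).
  rewrite alpha_def; have /andP[g0 g2] := gam_range k.
  by field; rewrite !gt_eqF //; lra.
have lam_range' k : 0 < lam k < 2 - gam k / (2 * beta) by rewrite -alphaE.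
have lam0 k : 0 < lam k by have /andP[] := lam_range k.
have err0 (c : nat -> H) k : 0 <= lam k * `|c k| by rewrite mulr_ge0 // ltW.
move/(nneseries_bounded_sums (err0 a)): a_sum => {}a_sum.
move/(nneseries_bounded_sums (err0 b)): b_sum => {}b_sum.
have rec k : x k.+1 = x k + lam k *:
    (resolvent (gam k) A (x k - gam k *: (B (x k) + b k)) + a k - x k).
  by rewrite x_rec y_def.
subst Omega.
split.
  exact: (dist_cvg dot_norm A_max beta_gt0 B_coco gam_range lam_range' a_sum b_sum rec).
move=> lam_low tau gam_low eps a1 a2 a3 a4 a5.
have gap0 : a1 -> a2 -> `|fb_residual A B (gam k) (x k)| @[k --> \oo] --> (0 : R).
  move=> [l0 llam] a2P.
  apply: (residual_cvg0_of_gap (tau := tau) dot_norm A_max beta_gt0 B_coco gam_range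
    lam_range' a_sum b_sum rec Omega_neq0 l0 _ llam).
    by have [/andP[tau0 _] _] := a2P 0%N.
  by move=> k; have [_] := a2P k; rewrite alphaE.
have div0 : a3 -> a5 -> `|fb_residual A B (gam k) (x k)| @[k --> \oo] --> (0 : R).
  move=> [g0 gl] [div gsum].
  apply: (residual_cvg0_of_divergence dot_norm A_max beta_gt0 B_coco gam_range
    lam_range' a_sum b_sum rec Omega_neq0 g0 gl).
    move=> bs; suff : (+oo < +oo :> \bar R)%E by rewrite ltxx.
    rewrite -{1}div; under eq_eseriesr do rewrite alphaE.
    apply/nneseries_bounded_sums => // k; have /andP[_ /ltW] := lam_range' k.
    by rewrite -subr_ge0; apply: mulr_ge0; exact: ltW.
  by apply/nneseries_bounded_sums.
split.
- by move=> [[h1 h2]|[h3 _ h5]]; [exact: gap0 | exact: div0].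
- by move=> [[h1 h2 [g0 gl]]|[[g0 gl] h4 h5]];
    apply: (iterates_weakly_cvg dot_norm A_max beta_gt0 B_coco gam_range lam_range'
      a_sum b_sum rec Omega_neq0 g0 gl); [exact: gap0 | apply: div0].
- by move=> [[h1 h2 [g0 gl]]|[h1 [g0 gl] h4 h5]] xs xsO;
    apply: (forward_values_cvg dot_norm A_max beta_gt0 B_coco gam_range lam_range'
      a_sum b_sum rec xsO g0 gl); [exact: gap0 | apply: div0].
Qed.
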